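(* Let $N_1,\dots,N_n$ be independent standard Gaussian random variables and let $M\subset\mathbb{R}^n$ be an arbitrary set such that its conic hull $\operatorname{pos} M$ is not a linear subspace. Then $$\upsilon_0(\operatorname{pos} M)=\mathbb{P}\Big[\inf_{(t_1,\dots,t_n)\in M}\sum_{i=1}^n t_iN_i\ge0\Big].$$
   Context: All sets are tacitly assumed to be Borel. A non-empty set $C\subset\mathbb{R}^n$ is a convex cone if $\lambda_1x_1+\lambda_2x_2\in C$ for all $x_1,x_2\in C$ and $\lambda_1,\lambda_2\ge0$; $\operatorname{pos} M$ is the smallest convex cone containing $M$ (the set of all finite linear combinations of elements of $M$ with non-negative coefficients). The conic intrinsic volumes $\upsilon_0(C),\dots,\upsilon_n(C)$ of a convex cone $C\subset\mathbb{R}^n$ are the unique real numbers such that $$\mathbb{P}[\operatorname{dist}^2(Z,C)\le r]=\sum_{k=0}^n\beta_{k,n}(r)\,\upsilon_k(C)\quad\text{for all } r,$$ where $Z$ is uniformly distributed on the unit sphere $\mathbb{S}^{n-1}$, $\operatorname{dist}(Z,C)=\inf\{|Z-y|:y\in C\}$ is the Euclidean distance, and $\beta_{k,n}$ is the distribution function of the Beta distribution with parameters $(n-k)/2$ and $k/2$, with the degenerate cases: $\beta_{0,n}$ is the distribution function of the unit mass at $1$ and $\beta_{n,n}$ that of the unit mass at $0$. *)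

(* Defs.v *)
(* MathComp-Analysis over an arbitrary [R : realType]; R^n is ['rV[R]_n]. *)
From HB Require Import structures.
From mathcomp Require Import all_boot all_order all_algebra.
From mathcomp Require Import all_classical all_reals all_analysis.

Set Implicit Arguments.
Unset Strict Implicit.
Unset Printing Implicit Defensive.

Import Order.TTheory GRing.Theory Num.Theory.
Import numFieldNormedType.Exports.

Local Open Scope classical_set_scope.
Local Open Scope ring_scope.

(* The Borel sets are generated by the product topology of ['rV[R]_n]. *)
Definition rVborel (R : realType) (n : nat) :=
  g_sigma_algebraType (@open 'rV[R]_n).

(* The norm that MathComp-Analysis puts on matrices is the sup norm, so the
   Euclidean norm and distance are introduced here. *)
Definition enorm (R : realType) (n : nat) (x : 'rV[R]_n) : R :=
  Num.sqrt (\sum_(i < n) x ord0 i ^+ 2).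

Definition edist_set (R : realType) (n : nat) (z : 'rV[R]_n)
    (C : set 'rV[R]_n) : R :=
  inf [set enorm (z - y) | y in C].

Definition convex_cone (R : realType) (n : nat) (C : set 'rV[R]_n) : Prop :=
  C !=set0 /\
  forall (l1 l2 : R) (x1 x2 : 'rV[R]_n),
    C x1 -> C x2 -> 0 <= l1 -> 0 <= l2 -> C (l1 *: x1 + l2 *: x2).

(* In particular [pos set0 = [set 0]]. *)
Definition pos (R : realType) (n : nat) (M : set 'rV[R]_n) : set 'rV[R]_n :=
  smallest (@convex_cone R n) M.

Definition linear_subspace (R : realType) (n : nat)
    (C : set 'rV[R]_n) : Prop :=
  exists U : {vspace 'rV[R]_n}, C = [set x | x \in U].

(* The uniform distribution on the unit sphere is the unique Borel probability
   measure on R^n that is carried by the sphere and invariant under all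
   orthogonal transformations. *)
Definition sphere_uniform (R : realType) (n : nat)
    (sigma : probability (rVborel R n) R) : Prop :=
  sigma [set x : rVborel R n | enorm x = 1] = 1%E /\
  forall (O : 'M[R]_n), O *m O^T = 1%:M ->
    forall A : set (rVborel R n), measurable A ->
      sigma [set x : rVborel R n | A (x *m O)] = sigma A.

(* Distribution function of Beta(a, b), for real a, b > 0; the library's
   [beta_prob] only has natural number parameters. *)
Definition beta_cdf (R : realType) (a b r : R) : R :=
  (\int[lebesgue_measure]_(x in [set x : R | 0 < x < 1 /\ x <= r])
     (x `^ (a - 1) * (1 - x) `^ (b - 1))) /
  (\int[lebesgue_measure]_(x in [set x : R | 0 < x < 1])
     (x `^ (a - 1) * (1 - x) `^ (b - 1))).

Definition steiner_beta (R : realType) (k n : nat) (r : R) : R :=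
  if k == 0%N then (if 1 <= r then 1 else 0)
  else if k == n then (if 0 <= r then 1 else 0)
  else beta_cdf ((n%:R - k%:R) / 2) (k%:R / 2) r.

(* [v] is the vector of conic intrinsic volumes of [C]: the spherical Steiner
   formula, which determines [v], holds for all real r. Here [sigma] is the
   law of the uniform random point Z. *)
Definition conic_intrinsic_volumes (R : realType) (n : nat)
    (C : set 'rV[R]_n) (v : 'I_n.+1 -> R) : Prop :=
  forall sigma : probability (rVborel R n) R, sphere_uniform sigma ->
  forall r : R,
    sigma [set z : rVborel R n | edist_set z C ^+ 2 <= r] =
    (\sum_(k < n.+1) steiner_beta k n r * v k)%:E.

Definition independent_RVs (R : realType) (d : measure_display)
    (T : measurableType d) (P : probability T R) (n : nat)
    (X : 'I_n -> {RV P >-> R}) : Prop :=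
  forall (J : {set 'I_n}) (B : 'I_n -> set R),
    (forall i, i \in J -> measurable (B i)) ->
    P [set w | forall i, i \in J -> B i (X i w)] =
    (\prod_(i in J) P (X i @^-1` B i))%E.

Definition standard_gaussian (R : realType) (d : measure_display)
    (T : measurableType d) (P : probability T R) (X : {RV P >-> R}) : Prop :=
  forall A : set R, measurable A -> distribution P X A = normal_prob 0 1 A.

(* Main.v *)
(* Let C = pos M and let Z be uniform on the sphere. Among the Steiner
   coefficients beta_k only beta_0 jumps at r = 1, so v_0 is the mass that
   dist^2(Z, C) gives to 1; since |Z| = 1 this is the probability that Z lies in
   the polar cone of C, equivalently in that of M. The hypothesis on v speaks of
   every uniform law on the sphere, so one has to be exhibited: the law of X / |X|
   for the Gaussian vector X = (N_1, ..., N_n). Its invariance under an orthogonal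
   matrix O is obtained by reducing O to a diagonal sign matrix with planar
   reflections, each of which preserves the product of two standard Gaussian laws
   (two affine changes of variables and Tonelli's theorem). Finally Z and -Z have
   the same law and X vanishes with probability 0. *)
Require Import Defs.
From HB Require Import structures.
From mathcomp Require Import all_boot all_order all_algebra.
From mathcomp Require Import all_classical all_reals all_analysis.
From mathcomp Require Import measurable_realfun ring lra.

Import Order.TTheory GRing.Theory Num.Theory.
Import numFieldNormedType.Exports.

Local Open Scope classical_set_scope.
Local Open Scope ring_scope.

(** * Changes of variables for Lebesgue measure *)

Section affine.
Context {R : realType}.
Notation mu := (@lebesgue_measure R).
Local Open Scope ereal_scope.

Lemma measurable_affine (a b : R) :
  measurable_fun setT (fun x : measurableTypeR R => (a * x + b)%R : measurableTypeR R).
Proof. by apply: measurable_funD => //; exact: measurable_funM. Qed.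

(** Lebesgue measure is determined by its values on half-open intervals, so it suffices to compare
    it there with the pushforward scaled by [|a|]. *)
Lemma lebesgue_measure_affine (a b : R) (A : set R) : a != 0%R -> measurable A ->
  mu A = `|a|%R%:E *
    pushforward mu (fun x : measurableTypeR R => (a * x + b)%R : measurableTypeR R) A.
Proof.
move=> a0 mA.
pose f := fun x : measurableTypeR R => (a * x + b)%R : measurableTypeR R.
pose nu : {measure set (measurableTypeR R) -> \bar R} :=
  mscale (NngNum (normr_ge0 a)) (pushforward mu f).
suff -> : mu A = nu (measurable_affine a b) A by [].
apply: lebesgue_measure_unique => //= _ [[l u]] _ <-.
rewrite -[RHS]/(`|a|%R%:E * mu (f @^-1` `]l, u]%classic)) {nu}.
have [lt|le] := ltP l u; last first.
  by rewrite set_itv_ge ?bnd_simp -?leNgt// preimage_set0 !measure0 mule0.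
have [ap|an] := ltP 0%R a.
  have -> : f @^-1` `]l, u]%classic = `]((l - b) / a)%R, ((u - b) / a)%R]%classic.
    apply/seteqP; split => x /=; rewrite !in_itv /= /f.
      by rewrite ltr_pdivrMr// ler_pdivlMr// ltrBlDr lerBrDr mulrC.
    by rewrite ltr_pdivrMr// ler_pdivlMr// ltrBlDr lerBrDr mulrC.
  rewrite !lebesgue_measure_itv /= !lte_fin lt ltr_pM2r ?invr_gt0// ltrD2r lt.
  rewrite -!EFinD -EFinM gtr0_norm//; congr EFin.
  by field.
have {an}an : (a < 0)%R by rewrite lt_neqAle a0.
(* A negative slope swaps the ends, so the preimage is closed on the left and open on the right; its
   length is unaffected. *)
have -> : f @^-1` `]l, u]%classic = `[((u - b) / a)%R, ((l - b) / a)%R[%classic.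
  apply/seteqP; split => x /=; rewrite !in_itv /= /f.
    by rewrite ltr_ndivlMr// ler_ndivrMr// ltrBlDr lerBrDr mulrC andbC.
  by rewrite ltr_ndivlMr// ler_ndivrMr// ltrBlDr lerBrDr mulrC andbC.
rewrite !lebesgue_measure_itv /= !lte_fin lt ltr_nM2r ?invr_lt0// ltrD2r lt.
rewrite -!EFinD -EFinM ltr0_norm//; congr EFin.
by field.
Qed.

Lemma ge0_integral_affine (a b : R) (f : R -> \bar R) : a != 0%R ->
  measurable_fun setT f -> (forall x, 0 <= f x) ->
  \int[mu]_x f x = `|a|%R%:E * \int[mu]_x f (a * x + b)%R.
Proof.
move=> a0 mf f0.
pose g := fun x : measurableTypeR R => (a * x + b)%R : measurableTypeR R.
pose nu : {measure set (measurableTypeR R) -> \bar R} :=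
  mscale (NngNum (normr_ge0 a)) (pushforward mu g).
rewrite (@eq_measure_integral _ _ _ _ (nu (measurable_affine a b)) mu).
  rewrite ge0_integral_mscale//= ge0_integral_pushforward//.
  exact: (measurable_affine a b).
by move=> A mA _; apply: lebesgue_measure_affine.
Qed.

(* Substitute [v = s * x - c * y] for [y] at fixed [x], exchange the integrals,
   and then substitute for [x] at fixed [v]. *)
Lemma ge0_integral_reflection (c s : R) (f : measurableTypeR R * measurableTypeR R -> \bar R) :
  (c ^+ 2 + s ^+ 2 = 1)%R -> c != 0%R -> measurable_fun setT f ->
  (forall z, 0 <= f z) ->
  \int[mu]_x \int[mu]_y f (c * x + s * y, s * x - c * y)%R =
  \int[mu]_x \int[mu]_y f (x, y).
Proof.
move=> cs c0 mf f0.
have mfst (p q r t : R) : measurable_fun setT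
    (fun z : measurableTypeR R * measurableTypeR R => f (p * z.1 + q * z.2, r * z.1 + t * z.2)%R).
  apply: (measurableT_comp mf); apply/measurable_fun_pairP; split => /=;
  by apply: measurable_funD; apply: measurable_funM.
(* The coefficient of [x] is [c + s ^+ 2 / c], which equals [c^-1] by [c ^+ 2 + s ^+ 2 = 1]. The
   trivial coefficients [0] and [1] keep the shape that [mfst] covers. *)
transitivity (\int[mu]_x (`|(- c^-1)%R|%R%:E *
    \int[mu]_v f (c^-1 * x + - (s / c) * v, 0 * x + 1 * v)%R)).
  apply: eq_integral => x _.
  rewrite (@ge0_integral_affine (- c^-1) (s * x / c)) ?oppr_eq0 ?invr_eq0//.
    congr (_ * _); apply: eq_integral => v _; congr f; congr (_, _).
      transitivity ((c ^+ 2 + s ^+ 2) / c * x + - (s / c) * v)%R; first by field.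
      by rewrite cs mul1r.
    by field.
  have := measurableT_comp (mfst c s s (- c)%R) (measurable_pair1 x).
  by rewrite /comp /=; under eq_fun do rewrite mulNr.
have mF := mfst (c^-1)%R (- (s / c))%R 0%R 1%R.
rewrite ge0_integralZl//; last 2 first.
- exact: (measurable_fun_fubini_tonelli_F (m2 := mu) _ mF).
- by move=> x _; exact: integral_ge0.
rewrite (fubini_tonelli (m1 := mu) (m2 := mu) _ mF)//=.
rewrite [RHS](fubini_tonelli (m1 := mu) (m2 := mu) f)//=.
rewrite -ge0_integralZl//; last 2 first.
- exact: (measurable_fun_fubini_tonelli_G (m1 := mu) _ mF).
- by move=> x _; exact: integral_ge0.
apply: eq_integral => v _.
(* The factor [|c^-1|] of this substitution matches the one left by the first. *)
rewrite [RHS](@ge0_integral_affine c^-1%R (- (s / c) * v)%R (fun x => f (x, v))) ?invr_eq0//.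
  by rewrite normrN; congr (_ * _); apply: eq_integral => x _; rewrite mul0r add0r mul1r.
exact: (measurableT_comp mf (measurable_pair2 v)).
Qed.

End affine.

(** * The standard Gaussian law on the plane *)

Section planar_gaussian.
Context {R : realType}.
Notation mu := (@lebesgue_measure R).
Notation mR := (measurableTypeR R).
Notation gamma := (normal_prob (0 : R) 1).
Notation phi := (normal_pdf (0 : R) 1).
Local Open Scope ereal_scope.

(** The product of the two densities depends only on [x ^+ 2 + y ^+ 2], which a reflection
    preserves. *)
Lemma normal_pdf_reflection (c s x y : R) : (c ^+ 2 + s ^+ 2 = 1)%R ->
  (phi (c * x + s * y) * phi (s * x - c * y) = phi x * phi y)%R.
Proof.
move=> cs; rewrite normal_pdfE ?oner_eq0// /normal_fun.
rewrite !subr0 mulrACA -expRD [RHS]mulrACA -expRD; congr (_ * expR _)%R.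
rewrite -!mulrDl -!opprD; congr (- _ * _)%R.
transitivity ((c ^+ 2 + s ^+ 2) * (x ^+ 2 + y ^+ 2))%R; first by ring.
by rewrite cs mul1r.
Qed.

Lemma normal_probE (B : set R) :
  gamma B = \int[mu]_x ((phi x)%:E * (\1_B x)%:E).
Proof.
rewrite -[LHS]/(\int[mu]_(x in B) (phi x)%:E) integral_mkcond.
by apply: eq_integral => x _; rewrite patchE indicE; case: ifPn; rewrite ?mule1 ?mule0.
Qed.

Let dens (z : mR * mR) := (phi z.1 * phi z.2)%:E.

Let dens_ge0 z : 0 <= dens z.
Proof. by rewrite lee_fin mulr_ge0// normal_pdf_ge0. Qed.

Let mdens : measurable_fun setT dens.
Proof.
apply/measurable_EFinP/measurable_funM.
  exact: (measurableT_comp (measurable_normal_pdf 0 1) measurable_fst).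
exact: (measurableT_comp (measurable_normal_pdf 0 1) measurable_snd).
Qed.

(** Integrating the joint density [dens] over a set defines a measure. By Tonelli it has the product
    value on rectangles, and the product measure is the only one that does. *)
Lemma normal_prob_productE (D : set (mR * mR)) : measurable D ->
  (gamma \x gamma) D =
  \int[mu]_x \int[mu]_y ((phi x * phi y)%:E * (\1_D (x, y))%:E).
Proof.
move=> mD.
pose f (D : set (mR * mR)) := \int[mu \x mu]_(z in D) dens z.
have f0 : f set0 = 0 by rewrite /f integral_set0.
have f1 A : 0 <= f A by apply: integral_ge0.
have f2 : semi_sigma_additive f.
  move=> F mF tF mUF; rewrite /f ge0_integral_bigcup//.
    by apply: is_cvg_ereal_nneg_natsum_cond => n _ _; apply: integral_ge0.
  exact: measurable_funTS.
pose nu : {measure set (mR * mR) -> \bar R} :=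
  HB.pack f (isMeasure.Build _ _ _ f f0 f1 f2).
have fE A : measurable A -> f A =
    \int[mu]_x \int[mu]_y ((phi x * phi y)%:E * (\1_A (x, y))%:E).
  move=> mA; rewrite /f integral_mkcond.
  transitivity (\int[mu \x mu]_z (dens z * (\1_A z)%:E)).
    by apply: eq_integral => z _; rewrite patchE indicE; case: ifPn; rewrite ?mule1 ?mule0.
  rewrite fubini_tonelli1//.
    apply: emeasurable_funM => //; apply/measurable_EFinP; exact: measurable_indic.
  by move=> z; rewrite mule_ge0// lee_fin indicE.
rewrite -fE//; apply: (@product_measure_unique _ _ _ _ _ gamma gamma nu) => //.
move=> A B mA mB; rewrite -[LHS]/(f (A `*` B)) fE; last exact: measurableX.
rewrite -[RHS]/(gamma A * gamma B).
rewrite (normal_probE A).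
have mphi : measurable_fun setT (fun x : mR => (phi x)%:E).
  by apply/measurable_EFinP; exact: measurable_normal_pdf.
have mpi C : measurable C -> measurable_fun setT (fun x : mR => (phi x)%:E * (\1_C x)%:E).
  by move=> mC; apply: emeasurable_funM => //; apply/measurable_EFinP; exact: measurable_indic.
rewrite -ge0_integralZr//; last 2 first.
- exact: mpi.
- by move=> x _; rewrite mule_ge0// lee_fin ?normal_pdf_ge0// indicE.
apply: eq_integral => x _.
rewrite (normal_probE B).
rewrite -ge0_integralZl//; last 3 first.
- exact: mpi.
- by move=> z _; rewrite mule_ge0// lee_fin ?normal_pdf_ge0// indicE.
- by rewrite mule_ge0// lee_fin ?normal_pdf_ge0// indicE.
apply: eq_integral => y _; rewrite !indicE in_setX/= EFinM.
by rewrite [RHS]muleACA -[in RHS]EFinM -natrM mulnb.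
Qed.

Lemma normal_probN (A : set R) : measurable A -> gamma (-%R @^-1` A) = gamma A.
Proof.
move=> mA.
rewrite !normal_probE.
rewrite [RHS](@ge0_integral_affine _ (-1)%R 0%R) ?oppr_eq0 ?oner_eq0//; last 2 first.
- apply: emeasurable_funM; apply/measurable_EFinP.
    exact: measurable_normal_pdf.
  exact: measurable_indic.
- by move=> x; rewrite mule_ge0// lee_fin ?normal_pdf_ge0// indicE.
rewrite normrN1 mul1e; apply: eq_integral => x _.
rewrite mulN1r addr0 !normal_pdfE ?oner_eq0// /normal_fun.
by rewrite !subr0 sqrrN !indicE; congr (_ * (_)%:R%:E).
Qed.

Lemma normal_prob_sign (s : R) (A : set R) : (s ^+ 2 = 1)%R -> measurable A ->
  gamma ( *%R s @^-1` A) = gamma A.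
Proof.
move=> /eqP; rewrite sqrf_eq1 => /orP[]/eqP -> mA.
  by have -> : *%R 1%R @^-1` A = A by apply/seteqP; split => x /=; rewrite mul1r.
have -> : *%R (-1)%R @^-1` A = -%R @^-1` A by apply/seteqP; split => x /=; rewrite mulN1r.
exact: normal_probN.
Qed.

(** Both the joint density and Lebesgue measure on the plane are invariant under the reflection. The
    substitution divides by [c], hence the separate case [c = 0]. *)
Lemma normal_prob_reflection (c s : R) (A B : set R) :
  (c ^+ 2 + s ^+ 2 = 1)%R -> measurable A -> measurable B ->
  (gamma \x gamma) [set z : mR * mR | A (c * z.1 + s * z.2)%R /\ B (s * z.1 - c * z.2)%R]
  = gamma A * gamma B.
Proof.
move=> cs mA mB.
have mc (p q : R) : measurable_fun setT (fun z : mR * mR => (p * z.1 + q * z.2)%R : mR).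
  by apply: measurable_funD; apply: measurable_funM.
have mD : measurable [set z : mR * mR | A (c * z.1 + s * z.2)%R /\ B (s * z.1 - c * z.2)%R].
  apply: measurableI.
    by rewrite -[X in measurable X]setTI; exact: mc.
  have := mc s (- c)%R; rewrite (_ : (fun z : mR * mR => _) = fun z => (s * z.1 - c * z.2)%R).
    by move=> /(_ measurableT _ mB); rewrite setTI.
  by apply/funext => z; rewrite mulNr.
(* [c = 0] is the exchange of the coordinates up to sign. *)
have [c0|c0] := eqVneq c 0%R.
  rewrite {}c0 in cs mD *.
  have s2 : (s ^+ 2 = 1)%R by rewrite -cs expr0n add0r.
  have ms C : measurable C -> measurable ( *%R s @^-1` C).
    by move=> mC; rewrite -[X in measurable X]setTI; exact: measurable_funM.
  rewrite (_ : [set z | _ ] = ( *%R s @^-1` B) `*` ( *%R s @^-1` A)).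
    rewrite product_measure1E; [|exact: ms|exact: ms].
    transitivity (gamma ( *%R s @^-1` B) * gamma ( *%R s @^-1` A)) => //.
    by rewrite !normal_prob_sign// muleC.
  by apply/seteqP; split => -[x y] /=; rewrite mul0r add0r mul0r subr0 => -[].
rewrite normal_prob_productE//.
pose F (z : mR * mR) := (phi z.1 * phi z.2)%:E * (\1_(A `*` B) z)%:E.
transitivity (\int[mu]_x \int[mu]_y F (c * x + s * y, s * x - c * y)%R).
  apply: eq_integral => x _; apply: eq_integral => y _.
  rewrite /F [(_, _).1]/= [(_, _).2]/= normal_pdf_reflection//.
rewrite ge0_integral_reflection//.
- by rewrite -normal_prob_productE ?product_measure1E//; exact: measurableX.
- apply: emeasurable_funM => //; apply/measurable_EFinP; apply: measurable_indic.
  exact: measurableX.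
- by move=> z; rewrite mule_ge0// lee_fin mulr_ge0// normal_pdf_ge0.
Qed.

End planar_gaussian.

(** * Measurability of finite conjunctions of events *)

Lemma measurable_forall_ord d (T : measurableType d) n (F : 'I_n -> set T) :
  (forall i, measurable (F i)) -> measurable [set w | forall i, F i w].
Proof.
move=> mF; rewrite (_ : [set w | _] = \bigcap_(i in [set: 'I_n]) F i).
  by apply: fin_bigcap_measurable => // i _.
by apply/seteqP; split => w /= Fw i; [move=> _|]; exact: Fw.
Qed.

Lemma measurable_impl d (T : measurableType d) (b : bool) (A : set T) :
  measurable A -> measurable [set w | b -> A w].
Proof.
case: b => mA; first by rewrite (_ : mkset _ = A)//; apply/seteqP; split => w /=; [exact|].
by rewrite (_ : mkset _ = setT)//; apply/seteqP; split.
Qed.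

(** * Gaussian vectors under orthogonal matrices *)

Section gaussian_vector.
Context {R : realType} {d : measure_display} {T : measurableType d} (P : probability T R)
  {n : nat}.
Notation mR := (measurableTypeR R).
Notation gamma := (normal_prob (0 : R) 1).

(** The product formula on boxes encodes independence and the marginal laws at once. *)
Definition gaussian_vector (X : T -> 'rV[R]_n) : Prop :=
  (forall i, measurable_fun setT (fun w => X w ord0 i)) /\
  forall B : 'I_n -> set R, (forall i, measurable (B i)) ->
    P [set w | forall i, B i (X w ord0 i)] = (\prod_(i < n) gamma (B i))%E.

Definition preserves_gaussian (E : 'M[R]_n) : Prop :=
  forall X, gaussian_vector X -> gaussian_vector (fun w => X w *m E).

(* The matrix [[c, s], [s, -c]] on the coordinates [i] and [j]. *)
Definition planar_reflection (i j : 'I_n) (c s : R) : 'M[R]_n :=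
  1%:M + (c - 1) *: delta_mx i i + s *: delta_mx i j + s *: delta_mx j i
  - (c + 1) *: delta_mx j j.

Lemma mul_planar_reflection i j c s (v : 'rV[R]_n) b : i != j ->
  (v *m planar_reflection i j c s) ord0 b =
  if b == i then c * v ord0 i + s * v ord0 j
  else if b == j then s * v ord0 i - c * v ord0 j else v ord0 b.
Proof.
move=> ij; have D k l : (v *m delta_mx k l) ord0 b = v ord0 k * (b == l)%:R.
  rewrite mxE (bigD1 k)//= mxE eqxx /= big1 ?addr0// => m mk.
  by rewrite mxE (negbTE mk) mulr0.
have ZD a (k l : 'I_n) : (a *: (v *m delta_mx k l)) ord0 b = a * (v ord0 k * (b == l)%:R).
  by rewrite mxE D.
rewrite /planar_reflection mulmxBr !mulmxDr mulmx1 -!scalemxAr.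
have mD (A B : 'rV[R]_n) : (A + B) ord0 b = A ord0 b + B ord0 b by rewrite mxE.
have mB (A B : 'rV[R]_n) : (A - B) ord0 b = A ord0 b - B ord0 b by rewrite !mxE.
rewrite mB !mD !ZD.
have [->|bi] := eqVneq b i; first by rewrite (negbTE ij) /=; ring.
have [->|bj] := eqVneq b j; rewrite /=; ring.
Qed.

Lemma planar_reflection_invol i j c s : i != j -> c ^+ 2 + s ^+ 2 = 1 ->
  planar_reflection i j c s *m planar_reflection i j c s = 1%:M.
Proof.
move=> ij cs; apply/row_matrixP => k; rewrite !rowE mulmxA mulmx1.
apply/rowP => b; rewrite !mul_planar_reflection// !eqxx (eq_sym j) (negbTE ij).
set v := delta_mx _ _.
have [->|bi] := eqVneq b i.
  transitivity ((c ^+ 2 + s ^+ 2) * v ord0 i); first by ring.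
  by rewrite cs mul1r.
have [->|bj] := eqVneq b j => //.
transitivity ((c ^+ 2 + s ^+ 2) * v ord0 j); first by ring.
by rewrite cs mul1r.
Qed.

Lemma tr_planar_reflection i j c s :
  (planar_reflection i j c s)^T = planar_reflection i j c s.
Proof.
rewrite /planar_reflection linearB !linearD /= !linearZ /= !trmx_delta trmx1.
by rewrite -!addrA; congr (_ + (_ + _)); rewrite addrCA.
Qed.

(** For fixed [B] both sides are finite measures in [D]. They agree on rectangles by the box
    formula, and rectangles determine a product measure. *)
Lemma gaussian_vector_pair X i j (D : set (mR * mR)) (B : 'I_n -> set R) :
  gaussian_vector X -> i != j -> measurable D -> (forall k, measurable (B k)) ->
  P [set w | D (X w ord0 i, X w ord0 j) /\
             forall k, k != i -> k != j -> B k (X w ord0 k)] =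
  ((gamma \x gamma) D * \prod_(k < n | (k != i) && (k != j)) gamma (B k))%E.
Proof.
move=> [mX gX] ij mD mB.
pose S := [set w | forall k, k != i -> k != j -> B k (X w ord0 k)].
have mS : measurable S.
  rewrite (_ : S = [set w | forall k, [set w | k != i -> k != j -> B k (X w ord0 k)] w])//.
  apply: measurable_forall_ord => k.
  do 2 apply: measurable_impl.
  by rewrite -[X in measurable X]setTI; exact: mX.
pose p : R := \prod_(k < n | (k != i) && (k != j)) fine (gamma (B k)).
have pE : (\prod_(k < n | (k != i) && (k != j)) gamma (B k) = p%:E)%E.
  rewrite -prodEFin; apply: eq_bigr => k _; rewrite fineK//.
  exact: (fin_num_measure gamma _ (mB k)).
have p0 : 0 <= p by apply: prodr_ge0 => k _; exact: fine_ge0.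
have mXX : measurable_fun setT (fun w => (X w ord0 i, X w ord0 j) : mR * mR).
  by apply/measurable_fun_pairP; split; exact: mX.
pose nu : {measure set (mR * mR) -> \bar R} :=
  pushforward (mrestr P mS) (fun w => (X w ord0 i, X w ord0 j) : mR * mR).
(* The constant [p] is absorbed into the first marginal, so that the target is a genuine product
   measure. *)
pose m1 : {finite_measure set mR -> \bar R} := mscale (NngNum p0) gamma.
transitivity (nu mXX D); first by [].
rewrite -(@product_measure_unique _ _ _ _ _ m1 gamma (nu mXX))//; last first.
  move=> A A' mA mA'.
  pose B' k := if k == i then A else if k == j then A' else B k.
  transitivity (P [set w | forall k, B' k (X w ord0 k)]).
    rewrite -[LHS]/(P ([set w | (A `*` A') (X w ord0 i, X w ord0 j)] `&` S)).
    congr (P _); apply/seteqP; split => w /=.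
      move=> [[Ai Aj] Sw] k; rewrite /B'; have [->//|ki] := eqVneq k i.
      by have [->//|kj] := eqVneq k j; exact: Sw.
    move=> B'w; split; first split.
    - by have := B'w i; rewrite /B' eqxx.
    - by have := B'w j; rewrite /B' eqxx eq_sym (negbTE ij).
    - move=> k /negbTE ki /negbTE kj; have := B'w k.
      by rewrite /B' ki kj.
  rewrite gX; last first.
    by move=> k; rewrite /B'; case: ifP => // _; case: ifP.
  rewrite (bigD1 i)//= (bigD1 j) ?(eq_sym j)//=.
  rewrite {1 2}/B' !eqxx (eq_sym j) (negbTE ij).
  rewrite (eq_bigr (fun k => gamma (B k))); last first.
    by move=> k /andP[/negbTE ki /negbTE kj]; rewrite /B' ki kj.
  rewrite pE muleA muleC.
  rewrite -[RHS]/(p%:E * gamma A * gamma A')%E.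
  by rewrite muleA.
rewrite /= /product_measure1 /= ge0_integral_mscale//=; last first.
  exact: (measurable_fun_xsection gamma mD).
by rewrite [LHS]muleC; congr (_ * _)%E; rewrite -pE.
Qed.

(** A box condition on the reflected vector constrains the coordinates [i] and [j] jointly and
    leaves the others in their box, which reduces the claim to the plane. *)
Lemma planar_reflection_preserves i j c s : i != j -> c ^+ 2 + s ^+ 2 = 1 ->
  preserves_gaussian (planar_reflection i j c s).
Proof.
move=> ij cs X gvX; have [mX gX] := gvX; split => [b|B mB].
  under eq_fun do rewrite mul_planar_reflection//.
  case: (b == i); last case: (b == j).
  - by apply: measurable_funD; apply: measurable_funM.
  - by apply: measurable_funB; apply: measurable_funM.
  - exact: mX.
pose D := [set z : mR * mR | B i (c * z.1 + s * z.2) /\ B j (s * z.1 - c * z.2)].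
have mD : measurable D.
  have mf : measurable_fun setT (fun z : mR * mR => (c * z.1 + s * z.2) : mR).
    by apply: measurable_funD; apply: measurable_funM.
  have mg : measurable_fun setT (fun z : mR * mR => (s * z.1 - c * z.2) : mR).
    by apply: measurable_funB; apply: measurable_funM.
  by apply: measurableI; rewrite -[X in measurable X]setTI;
    [exact: (mf measurableT _ (mB i))|exact: (mg measurableT _ (mB j))].
transitivity (P [set w | D (X w ord0 i, X w ord0 j) /\
             forall k, k != i -> k != j -> B k (X w ord0 k)]).
  congr (P _); apply/seteqP; split => w /=.
    move=> Bw; split; first split.
    - by have := Bw i; rewrite mul_planar_reflection// eqxx.
    - by have := Bw j; rewrite mul_planar_reflection// eqxx eq_sym (negbTE ij).
    - move=> k /negbTE ki /negbTE kj; have := Bw k.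
      by rewrite mul_planar_reflection// ki kj.
  move=> [[Bi Bj] Bk] k; rewrite mul_planar_reflection//.
  have [->//|ki] := eqVneq k i; have [->//|kj] := eqVneq k j; exact: Bk.
rewrite gaussian_vector_pair//.
rewrite normal_prob_reflection//.
by rewrite [RHS](bigD1 i)//= [X in (_ = _ * X)%E](bigD1 j) ?(eq_sym j)//= muleA.
Qed.

Lemma diag_sign_preserves (O : 'M[R]_n) : (forall a b, b != a -> O a b = 0) ->
  (forall a, O a a ^+ 2 = 1) -> preserves_gaussian O.
Proof.
move=> O0 O1 X [mX gX].
have XO w b : (X w *m O) ord0 b = O b b * X w ord0 b.
  rewrite mxE (bigD1 b)//= big1 ?addr0 1?mulrC// => k kb.
  by rewrite O0 ?mulr0// eq_sym.
split => [i|B mB]; first by under eq_fun do rewrite XO; exact: measurable_funM.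
rewrite (_ : [set w | _] = [set w | forall i, ( *%R (O i i) @^-1` B i) (X w ord0 i)]).
  rewrite (gX (fun i => *%R (O i i) @^-1` B i)).
    by apply: eq_bigr => i _; rewrite normal_prob_sign.
  by move=> i; rewrite -[X in measurable X]setTI; exact: measurable_funM.
by apply/seteqP; split => w /= H i; have := H i; rewrite XO.
Qed.

Lemma mul_planar_reflection_mx (O : 'M[R]_n) i j c s a b : i != j ->
  (O *m planar_reflection i j c s) a b =
  if b == i then c * O a i + s * O a j
  else if b == j then s * O a i - c * O a j else O a b.
Proof.
move=> ij; have := @mul_planar_reflection i j c s (row a O) b ij.
by rewrite -row_mul mxE => ->; rewrite !mxE.
Qed.

Lemma orthogonal_preserves (O : 'M[R]_n) : O *m O^T = 1%:M -> preserves_gaussian O.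
Proof.
(* Induction on the number [m] of rows that are not yet diagonal. *)
suff H m : forall O : 'M[R]_n, O *m O^T = 1%:M ->
    (forall a b : 'I_n, (a < n - m)%N -> b != a -> O a b = 0) -> preserves_gaussian O.
  by move=> OO; apply: (H n) => // a b; rewrite subnn.
have dot (O' : 'M[R]_n) a b : O' *m O'^T = 1%:M -> \sum_k O' a k * O' b k = (a == b)%:R.
  move=> /matrixP /(_ a b); rewrite !mxE => <-.
  by apply: eq_bigr => k _; rewrite mxE.
have diag2 (O' : 'M[R]_n) a : O' *m O'^T = 1%:M -> (forall b, b != a -> O' a b = 0) ->
    O' a a ^+ 2 = 1.
  move=> OO O0; have := dot _ a a OO.
  rewrite eqxx (bigD1 a)//= big1 ?addr0 -?expr2// => k ka.
  by rewrite O0 ?mulr0.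
elim: m => [{}O OO O0|m IH {}O OO O0].
  have {}O0 a b : b != a -> O a b = 0 by apply: O0; rewrite subn0.
  by apply: diag_sign_preserves => // a; apply: diag2 => // b; exact: O0.
(* If [n <= m], the truncated difference [n - m] is 0 and the condition on the rows is vacuous. *)
have [nm|mn] := leqP n m.
  by apply: IH => // a b; have /eqP -> : (n - m)%N == 0 by rewrite subn_eq0.
(* Row [n - m.+1] is the first one not yet known to be diagonal. *)
have kn : (n - m.+1 < n)%N by rewrite ltn_subrL/= (leq_trans _ mn).
pose k := Ordinal kn.
have nmE : (n - m)%N = k.+1 by rewrite /= subnSK.
(* Inner induction on the number of nonzero entries of row [k] to the right of the diagonal. *)
have [t] := ubnP #|[pred j : 'I_n | (k < j)%N && (O k j != 0)]|.
elim: t O OO O0 => // t IHt O OO O0 /ltnSE card_t.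
case: (pickP [pred j : 'I_n | (k < j)%N && (O k j != 0)]) => [j /andP[kj Okj]|none]; last first.
  (* Nothing is left to the right of the diagonal. To the left, row [k] is orthogonal to each
     earlier row [b], whose only nonzero entry is [O b b], so [O k b = 0]. *)
  apply: IH => // a b; rewrite nmE ltnS leq_eqVlt => /orP[/eqP/val_inj ->|]; last exact: O0.
  rewrite neq_ltn => /orP[bk|kb]; last first.
    by have /= := none b; rewrite kb /= => /negbFE/eqP.
  have := dot _ k b OO.
  have -> : (k == b) = false by apply/negbTE; rewrite neq_ltn bk orbT.
  rewrite (bigD1 b)//= big1 ?addr0; last first.
    by move=> x xb; rewrite (O0 b x)// mulr0.
  move/eqP; rewrite mulf_eq0 => /orP[/eqP//|/eqP Obb].
  have := @diag2 _ b OO (fun x => @O0 b x bk).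
  by rewrite Obb expr0n => /esym/eqP; rewrite oner_eq0.
have kjn : k != j by rewrite neq_ltn kj.
(* The reflection sends [(O k k, O k j)] to [(r, 0)]. *)
pose r := Num.sqrt (O k k ^+ 2 + O k j ^+ 2).
have r2 : r ^+ 2 = O k k ^+ 2 + O k j ^+ 2 by rewrite sqr_sqrtr// addr_ge0 ?sqr_ge0.
have r0 : r ^+ 2 != 0.
  by rewrite r2 paddr_eq0 ?sqr_ge0// negb_and !expf_eq0/= Okj orbT.
have cs : (O k k / r) ^+ 2 + (O k j / r) ^+ 2 = 1.
  by rewrite !expr_div_n -mulrDl -r2 divff.
pose H := planar_reflection k j (O k k / r) (O k j / r).
have HH : H *m H = 1%:M by exact: planar_reflection_invol.
(* As [H] is an involution, [O] is the product of [O *m H] and [H]. *)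
suff OH : preserves_gaussian (O *m H).
  move=> X gX; have := planar_reflection_preserves _ _ _ _ kjn cs _ (OH _ gX).
  by congr gaussian_vector; apply/funext => w; rewrite -!mulmxA HH mulmx1.
apply: IHt.
- by rewrite trmx_mul tr_planar_reflection mulmxA -(mulmxA O) HH mulmx1.
(* Earlier rows vanish in columns [k] and [j], so the reflection does not disturb them. *)
- move=> a b ak ba; have Oz x : x != a -> O a x = 0 by exact: O0.
  have ka : k != a by rewrite neq_ltn ak orbT.
  have ja : j != a by rewrite neq_ltn (ltn_trans ak kj) orbT.
  rewrite mul_planar_reflection_mx// !Oz// !mulr0 subrr addr0.
  by do 2 case: ifP => // _.
(* The entry in column [j] becomes 0 and the others to the right of column [k] are unchanged, so the
   count drops. *)
- apply: leq_trans card_t; apply: proper_card; apply/properP; split.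
    apply/fintype.subsetP => x; rewrite !inE => /andP[kx]; rewrite kx mul_planar_reflection_mx//.
    have -> : (x == k) = false by apply/negbTE; rewrite neq_ltn kx orbT.
    by have [->|] := eqVneq x j.
  exists j; rewrite !inE ?kj ?Okj// mul_planar_reflection_mx// eqxx (eq_sym j) (negbTE kjn).
  by rewrite negbK; apply/eqP; ring.
Qed.

End gaussian_vector.

(** * Borel sets of ['rV[R]_n] and laws of random vectors *)

Section borel_rV.
Context {R : realType} {n : nat}.
Notation mR := (measurableTypeR R).

(** A countable family of sup norm balls, used as a base of the topology. *)
Definition rat_box (q : 'rV[rat]_n) (k : nat) : set 'rV[R]_n :=
  [set y | forall i, `|ratr (q ord0 i) - y ord0 i| < k.+1%:R^-1].

Lemma open_rat_box (U : set 'rV[R]_n) : open U ->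
  U = \bigcup_(qk in [set qk : 'rV[rat]_n * nat | rat_box qk.1 qk.2 `<=` U])
        rat_box qk.1 qk.2.
Proof.
move=> oU; apply/seteqP; split => [y Uy|y [qk sU]]; last exact: sU.
have /nbhs_ballP[e /= e0 sU] : nbhs y U by exact: open_nbhs_nbhs.
(* Two points of the box are compared through its centre, so twice the radius has to stay below
   [e]. *)
have [k ke] : exists k : nat, k.+1%:R^-1 < e / 2.
  have [k] := ltr_add_invr (divr_gt0 e0 (ltr0n _ 2)).
  by rewrite add0r => ?; exists k.
have k0 : 0 < k.+1%:R^-1 :> R by rewrite invr_gt0.
have qE i : exists q : rat, `|ratr q - y ord0 i| < k.+1%:R^-1.
  have [|q] := @rat_in_itvoo R (y ord0 i - k.+1%:R^-1) (y ord0 i + k.+1%:R^-1).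
    by rewrite ltrBlDr -addrA ltrDl addr_gt0.
  rewrite in_itv /= => /andP[q1 q2]; exists q.
  by rewrite ltr_distl q1.
pose q : 'rV[rat]_n := \row_i projT1 (cid (qE i)).
have qy : rat_box q k y by move=> i; rewrite mxE; case: cid.
exists (q, k) => //= z zq; apply: sU; split=> // i j.
rewrite (ord1 i) /ball /=.
apply: (le_lt_trans (ler_distD (ratr (q ord0 j)) _ _)).
rewrite [e]splitr ltrD// (lt_trans _ ke)//; first by rewrite distrC; exact: qy.
Qed.

(** The preimage of an open set is a countable union of preimages of boxes, each a finite
    intersection of coordinate events. *)
Lemma measurable_fun_rV d (T : measurableType d) (X : T -> 'rV[R]_n) :
  (forall i, measurable_fun setT (fun w => X w ord0 i)) ->
  measurable_fun setT (X : T -> rVborel R n).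
Proof.
move=> mX; apply: (@measurability _ _ T (rVborel R n) setT X (@open 'rV[R]_n) erefl) => _ [U oU <-].
rewrite setTI (open_rat_box U oU) preimage_bigcup.
rewrite bigcup_mkcond; apply: countable_bigcupT_measurable => // -[q k].
case: ifP => // _.
apply: (@measurable_forall_ord _ T n
  (fun i => (fun w => X w ord0 i) @^-1` ball (ratr (q ord0 i) : R) k.+1%:R^-1)) => i.
by rewrite -[X in measurable X]setTI; apply: mX => //; exact: measurable_ball.
Qed.

Lemma open_measurable_rV (U : set 'rV[R]_n) : open U -> measurable (U : set (rVborel R n)).
Proof. by move=> oU; exact: sub_sigma_algebra. Qed.

Lemma continuous_measurable_fun_rV (f : 'rV[R]_n -> R) : continuous f ->
  measurable_fun setT (f : rVborel R n -> R).
Proof.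
move=> /continuousP cf; apply: (measurability (@RGenOInfty.G R)).
  exact: RGenOInfty.measurableE.
move=> _ [_ [x ->] <-]; rewrite setTI; apply: open_measurable_rV.
exact: cf.
Qed.

Lemma measurable_coord (i : 'I_n) :
  measurable_fun setT (fun x : rVborel R n => (x : 'rV[R]_n) ord0 i).
Proof. apply: continuous_measurable_fun_rV; exact: coord_continuous. Qed.

(** Measurable boxes are stable under intersection and generate the Borel sets, so two probability
    laws that agree on them are equal. *)
Lemma gaussian_law_unique d (T : measurableType d) (P : probability T R)
    (X Y : T -> 'rV[R]_n) : gaussian_vector P X -> gaussian_vector P Y ->
  forall A : set (rVborel R n), measurable A -> P (X @^-1` A) = P (Y @^-1` A).
Proof.
move=> [mX gX] [mY gY].
pose G : set (set (rVborel R n)) := [set A | exists B : 'I_n -> set R,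
  (forall i, measurable (B i)) /\
  A = [set x : rVborel R n | forall i, B i ((x : 'rV[R]_n) ord0 i)]].
pose X' : T -> rVborel R n := X.
pose Y' : T -> rVborel R n := Y.
pose m1 : {measure set (rVborel R n) -> \bar R} := pushforward P X'.
pose m2 : {measure set (rVborel R n) -> \bar R} := pushforward P Y'.
have mX' := measurable_fun_rV _ _ X mX.
have mY' := measurable_fun_rV _ _ Y mY.
move=> A mA; rewrite -[LHS]/(m1 mX' A) -[RHS]/(m2 mY' A).
have Gsub : G `<=` measurable.
  move=> _ [B [mB ->]]; apply: measurable_forall_ord => i.
  rewrite -[X in measurable X]setTI; exact: measurable_coord.
have GT : G setT.
  by exists (fun=> setT); split => //; apply/seteqP; split.
apply: (measure_unique G (fun=> setT)) => //.
- apply/seteqP; split; last first.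
    by apply: smallest_sub => //; exact: sigma_algebra_measurable.
  (* The coordinates are measurable for the sigma-algebra generated by boxes; measurability of the
     identity then says that this sigma-algebra contains every Borel set. *)
  have : measurable_fun setT (idfun : g_sigma_algebraType G -> rVborel R n).
    apply: measurable_fun_rV => i _ B mB; rewrite setTI.
    apply: sub_sigma_algebra.
    exists (fun j => if j == i then B else setT); split.
      by move=> j; case: ifP.
    apply/seteqP; split => x /=; first by move=> Bx j; case: eqVneq => // ->.
    by move=> /(_ i); rewrite eqxx.
  by move=> H C mC; have := H measurableT C mC; rewrite setTI.
- move=> _ _ [B [mB ->]] [C [mC ->]]; exists (fun i => B i `&` C i); split.
    by move=> i; exact: measurableI.
  apply/seteqP; split => x /=; first by move=> [Bx Cx] i; split.
  by move=> BCx; split => i; have [] := BCx i.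
- by rewrite bigcup_const.
- by move=> _ [B [mB ->]]; rewrite -[LHS]/(P _) -[RHS]/(P _) /preimage /= gX// gY.
- by move=> k; rewrite -[X in (X < _)%E]/(P setT) probability_setT ltry.
Qed.

End borel_rV.

(** * Euclidean norm, distance to a set, and the polar cone *)

Section euclidean.
Context {R : realType} {n : nat}.
Implicit Types x y z : 'rV[R]_n.

Definition dot x y : R := \sum_(i < n) x ord0 i * y ord0 i.

Lemma enorm_ge0 x : 0 <= enorm x. Proof. exact: sqrtr_ge0. Qed.

Lemma sqr_enorm x : enorm x ^+ 2 = dot x x.
Proof.
rewrite sqr_sqrtr; last by apply: sumr_ge0 => i _; exact: sqr_ge0.
by apply: eq_bigr => i _; rewrite expr2.
Qed.

Lemma enorm_eq0 x : (enorm x == 0) = (x == 0).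
Proof.
apply/idP/idP => [/eqP e0|/eqP ->].
  have : dot x x = 0 by rewrite -sqr_enorm e0 expr0n.
  move/eqP; rewrite psumr_eq0; last by move=> i _; rewrite -expr2 sqr_ge0.
  move/allP => x0; apply/eqP/rowP => i; rewrite mxE; apply/eqP.
  by have := x0 i (mem_index_enum _); rewrite mulf_eq0 orbb.
by rewrite /enorm big1 ?sqrtr0// => i _; rewrite mxE expr0n.
Qed.

Lemma dotZl a x y : dot (a *: x) y = a * dot x y.
Proof. by rewrite /dot mulr_sumr; apply: eq_bigr => i _; rewrite mxE mulrA. Qed.

Lemma dotC x y : dot x y = dot y x.
Proof. by apply: eq_bigr => i _; rewrite mulrC. Qed.

Lemma dotDr x y z : dot x (y + z) = dot x y + dot x z.
Proof. by rewrite /dot -big_split; apply: eq_bigr => i _; rewrite mxE mulrDr. Qed.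

Lemma dotZr a x y : dot x (a *: y) = a * dot x y.
Proof. by rewrite dotC dotZl dotC. Qed.

Lemma enormZ a x : enorm (a *: x) = `|a| * enorm x.
Proof.
apply/eqP; rewrite -(@eqrXn2 _ 2)//; last 2 first.
- exact: enorm_ge0.
- by rewrite mulr_ge0 ?enorm_ge0.
by rewrite exprMn !sqr_enorm dotZl dotZr mulrA -normrX ger0_norm ?sqr_ge0.
Qed.

Lemma enorm_orthogonal (O : 'M[R]_n) x : O *m O^T = 1%:M -> enorm (x *m O) = enorm x.
Proof.
move=> OO; have dotE y : dot y y = (y *m y^T) ord0 ord0.
  by rewrite mxE; apply: eq_bigr => i _; rewrite mxE.
apply/eqP; rewrite -(@eqrXn2 _ 2)// ?enorm_ge0// !sqr_enorm !dotE.
by rewrite trmx_mul mulmxA -(mulmxA x) OO mulmx1.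
Qed.

Lemma sqr_enormB x y :
  enorm (x - y) ^+ 2 = enorm x ^+ 2 - 2 * dot x y + enorm y ^+ 2.
Proof.
rewrite !sqr_enorm /dot mulr_sumr -sumrB -big_split; apply: eq_bigr => i _ /=.
by rewrite !mxE; ring.
Qed.

Lemma continuous_enormB y : continuous (fun z : 'rV[R]_n => enorm (z - y)).
Proof.
move=> z.
apply: (@continuous_comp _ _ _ (fun z : 'rV[R]_n => \sum_(i < n) (z - y) ord0 i ^+ 2) Num.sqrt);
  last exact: sqrt_continuous.
suff H (s : seq 'I_n) : continuous (fun z0 : 'rV[R]_n => \sum_(i <- s) (z0 - y) ord0 i ^+ 2).
  exact: H.
elim: s => [|i s IH] u.
  rewrite (_ : (fun _ => _) = cst 0); first exact: cst_continuous.
  by apply/funext => v; rewrite big_nil.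
rewrite (_ : (fun _ => _) = fun v : 'rV[R]_n =>
    (v ord0 i - y ord0 i) ^+ 2 + \sum_(i <- s) (v - y) ord0 i ^+ 2); last first.
  by apply/funext => v; rewrite big_cons !mxE.
apply: (@cvgD _ R^o _ (nbhs u) (nbhs_filter u)); last exact: IH.
have cB : (fun v : 'rV[R]_n => v ord0 i - y ord0 i) @ u --> (u ord0 i - y ord0 i : R).
  by apply: (@cvgB _ R^o _ (nbhs u) (nbhs_filter u) (fun v : 'rV[R]_n => v ord0 i)
    (cst (y ord0 i))); [exact: (@coord_continuous R 1 n ord0 i u)|exact: cvg_cst].
exact: (cvg_comp _ _ cB (@exprn_continuous R 2 _)).
Qed.

Lemma measurable_enorm : measurable_fun setT (@enorm R n : rVborel R n -> R).
Proof.
apply: continuous_measurable_fun_rV => z.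
by have := continuous_enormB 0 z; under [fun _ => _]eq_fun do rewrite subr0.
Qed.

Lemma measurable_rV_set0 : measurable ([set 0] : set (rVborel R n)).
Proof.
rewrite (_ : [set 0] = [set x : rVborel R n | enorm x = 0]).
  rewrite -[X in measurable X]setTI; exact: (measurable_enorm measurableT [set 0]).
by apply/seteqP; split => x /= /eqP; rewrite ?enorm_eq0 => /eqP// ->; apply/eqP; rewrite enorm_eq0.
Qed.

(** Radial projection onto the unit sphere; since [0^-1 = 0], the origin is sent to itself. *)
Definition normalize x : 'rV[R]_n := (enorm x)^-1 *: x.

Lemma measurable_normalize :
  measurable_fun setT (normalize : rVborel R n -> rVborel R n).
Proof.
apply: measurable_fun_rV => i.
(* The inverse becomes a real power, whose measurability is known; the two agree at 0 as well. *)
rewrite (_ : (fun _ => _) = fun x : rVborel R n => enorm x `^ (-1) * (x : 'rV[R]_n) ord0 i).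
  apply: measurable_funM; last exact: measurable_coord.
  exact: measurableT_comp (measurable_powR _) measurable_enorm.
by apply/funext => x; rewrite mxE powR_inv1// enorm_ge0.
Qed.

Lemma enorm_normalize x : x != 0 -> enorm (normalize x) = 1.
Proof.
move=> x0; rewrite enormZ ger0_norm ?invr_ge0 ?enorm_ge0// mulVf//.
by rewrite enorm_eq0.
Qed.

(** The strict inequality provides a witness even when the infimum is not attained. *)
Lemma edist_set_ltP z (C : set 'rV[R]_n) r : C !=set0 ->
  edist_set z C < r <-> exists2 y, C y & enorm (z - y) < r.
Proof.
move=> [y0 Cy0]; split.
  by move/inf_lt => [|_ [y Cy <-] ?]; [exists (enorm (z - y0)), y0|exists y].
move=> [y Cy yr]; apply: le_lt_trans yr; apply: ge_inf; last by exists y.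
by exists 0 => _ [u _ <-]; exact: enorm_ge0.
Qed.

Lemma edist_set_ge0 z (C : set 'rV[R]_n) : C !=set0 -> 0 <= edist_set z C.
Proof.
by move=> C0; rewrite leNgt; apply/negP => /(edist_set_ltP _ _ _ C0)[y _]; rewrite ltNge enorm_ge0.
Qed.

(** The points at distance less than [r] form a union, over [y] in [C], of open sets, hence an open
    set. *)
Lemma measurable_edist_set (C : set 'rV[R]_n) : C !=set0 ->
  measurable_fun setT ((@edist_set R n)^~ C : rVborel R n -> R).
Proof.
move=> C0; apply: (measurability (@RGenCInfty.G R)).
  exact: RGenCInfty.measurableE.
move=> _ [_ [r ->] <-]; rewrite setTI -[X in measurable X]setCK.
apply: measurableC; apply: open_measurable_rV.
rewrite (_ : ~` _ = \bigcup_(y in C) (fun z => enorm (z - y)) @^-1` [set t | t < r]).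
  apply: bigcup_open => y _; apply: open_comp => //.
  by move=> z _; exact: continuous_enormB.
apply/seteqP; split => z /=; rewrite in_itv/= andbT.
  by move/negP; rewrite -ltNge => /(edist_set_ltP _ _ _ C0)[y Cy ?]; exists y.
by move=> [y Cy ?]; apply/negP; rewrite -ltNge; apply/(edist_set_ltP _ _ _ C0); exists y.
Qed.

(** A ray has points nearer to [z] than its apex exactly when it makes an acute angle with [z]; the
    condition thus describes the polar cone. *)
Lemma edist_set_ge1P (C : set 'rV[R]_n) z : convex_cone C -> enorm z = 1 ->
  ~ (edist_set z C ^+ 2 < 1) <-> forall y, C y -> dot z y <= 0.
Proof.
move=> [C0 CC] z1; rewrite expr_lt1// ?edist_set_ge0//; split => H.
  move=> y Cy; rewrite leNgt; apply/negP => zy; apply: H; apply/(edist_set_ltP _ _ _ C0).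
  have y0 : 0 < enorm y ^+ 2.
    rewrite lt_neqAle sqr_ge0 andbT eq_sym expf_eq0/= enorm_eq0.
    apply/negP => /eqP y0; move: zy; rewrite y0 /dot big1 ?ltxx// => i _.
    by rewrite mxE mulr0.
  (* [t *: y] is the orthogonal projection of [z] on the ray of [y], at squared distance
     [1 - t * dot z y]. *)
  pose t := dot z y / enorm y ^+ 2.
  have t0 : 0 < t by rewrite divr_gt0.
  exists (t *: y).
    have := CC t 0 y y Cy Cy (ltW t0) (lexx _); by rewrite scale0r addr0.
  rewrite -(@expr_lt1 _ 2) ?enorm_ge0// sqr_enormB z1 expr1n enormZ dotZr exprMn.
  rewrite ger0_norm ?(ltW t0)//.
  rewrite (_ : t ^+ 2 * enorm y ^+ 2 = t * dot z y); last first.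
    by rewrite /t; field; move: y0; rewrite lt0r expf_eq0/= => /andP[].
  have : 0 < t * dot z y by rewrite mulr_gt0.
  lra.
move=> /(edist_set_ltP _ _ _ C0)[y Cy]; rewrite -(@expr_lt1 _ 2) ?enorm_ge0// sqr_enormB z1 expr1n.
have := H y Cy; have := sqr_ge0 (enorm y); lra.
Qed.

End euclidean.

(** * The uniform law on the sphere from a Gaussian vector *)

Section sphere.
Context {R : realType} {n : nat} {d : measure_display} {T : measurableType d}
  (P : probability T R).
Notation gamma := (normal_prob (0 : R) 1).

(** Already the first coordinate vanishes with probability 0, because its law has a density. *)
Lemma gaussian_vector_eq0 (X : T -> 'rV[R]_n.+1) : gaussian_vector P X ->
  P (X @^-1` [set 0]) = 0%E.
Proof.
move=> gX; have [mX gXE] := gX.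
pose B (i : 'I_n.+1) : set R := if i == ord0 then [set 0] else setT.
have mB i : measurable (B i) by rewrite /B; case: ifP.
have P0 : P [set w | forall i, B i (X w ord0 i)] = 0%E.
  rewrite gXE// (bigD1 ord0)//= {1}/B eqxx.
  by rewrite /normal_prob integral_set1 mul0e.
apply/eqP; rewrite eq_le measure_ge0 andbT -P0; apply: le_measure; rewrite ?inE.
- rewrite -[X in measurable X]setTI.
  exact: (measurable_fun_rV _ _ X mX measurableT _ measurable_rV_set0).
- apply: measurable_forall_ord => i; rewrite -[X in measurable X]setTI; exact: mX.
- by move=> w /= -> i; rewrite mxE /B; case: ifP.
Qed.

Definition sphere_law (X : T -> 'rV[R]_n.+1) (mX : measurable_fun setT (X : T -> rVborel R n.+1))
    : probability (rVborel R n.+1) R :=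
  distribution P (mfun_Sub (mem_set (measurableT_comp measurable_normalize mX))).

Lemma sphere_lawE X mX A : sphere_law X mX A = P (X @^-1` (normalize @^-1` A)).
Proof. by []. Qed.

(** Orthogonal maps commute with [normalize], so the invariance of the Gaussian law passes to the
    sphere. *)
Lemma sphere_law_uniform (X : T -> 'rV[R]_n.+1) mX : gaussian_vector P X ->
  sphere_uniform (sphere_law X mX).
Proof.
move=> gX; split; rewrite ?sphere_lawE.
  have mS : measurable (X @^-1` (normalize @^-1` [set x : rVborel R n.+1 | enorm x = 1])).
    rewrite -[X in measurable X]setTI; apply: mX => //.
    rewrite -[X in measurable X]setTI; apply: measurable_normalize => //.
    rewrite -[X in measurable X]setTI; exact: (measurable_enorm measurableT [set 1]).
  apply/eqP; rewrite eq_le probability_le1//=.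
  rewrite -[X in (X <= _)%E](sube0 1) -(gaussian_vector_eq0 X gX).
  have m0 : measurable (X @^-1` [set 0]).
    rewrite -[X in measurable X]setTI.
    exact: (mX measurableT _ measurable_rV_set0).
  rewrite -probability_setC//; apply: le_measure; rewrite ?inE//; first exact: measurableC.
  by move=> w /= /eqP; exact: enorm_normalize.
move=> O OO A mA; rewrite sphere_lawE.
have mA' : measurable (normalize @^-1` A : set (rVborel R n.+1)).
  by rewrite -[X in measurable X]setTI; exact: measurable_normalize.
have := gaussian_law_unique _ _ _ _ _ (orthogonal_preserves _ _ OO _ gX) gX _ mA'.
rewrite sphere_lawE => <-; congr (P _); apply/seteqP; split => w /=;
by rewrite /normalize enorm_orthogonal// scalemxAl.
Qed.

End sphere.

(** * Steiner coefficients near 1 and the intrinsic volume of index 0 *)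

Section steiner.
Context {R : realType}.
Notation mu := (@lebesgue_measure R).

(** The domains of integration increase to the whole open unit interval, so monotone convergence
    applies. *)
Lemma beta_cdf_cvg1 (a b : R) :
  beta_cdf a b (1 - m.+1%:R^-1) @[m --> \oo] --> beta_cdf a b 1.
Proof.
rewrite /beta_cdf; pose g (x : R) := x `^ (a - 1) * (1 - x) `^ (b - 1).
pose S (r : R) := [set x : R | 0 < x < 1 /\ x <= r].
have S1 : S 1 = [set x : R | 0 < x < 1].
  by apply/seteqP; split => x /= => [[]//|x01]; split => //; have /andP[_ /ltW] := x01.
rewrite -S1.
have mg : measurable_fun setT g.
  apply: measurable_funM; first exact: measurable_powR.
  apply: (measurableT_comp (measurable_powR _)).
  exact: measurable_funB.
have mS r : measurable (S r).
  rewrite (_ : S r = `]0, 1[%classic `&` `]-oo, r]%classic).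
    by apply: measurableI; exact: measurable_itv.
  by apply/seteqP; split => x /=; rewrite !in_itv.
have SU : \bigcup_m S (1 - m.+1%:R^-1) = S 1.
  apply/seteqP; split => [x [m _ []]|x [x01 _]].
    by move=> x01 _; split => //; have /andP[_ /ltW] := x01.
  have /andP[_ x1] := x01.
  have [m] := ltr_add_invr x1.
  by move=> xm; exists m => //; split => //; rewrite lerBrDr ltW.
have cvg_int : (\int[mu]_(x in S (1 - m.+1%:R^-1)%R) (g x)%:E)%E @[m --> \oo] -->
    (\int[mu]_(x in S 1%R) (g x)%:E)%E.
  rewrite -SU; apply: (@ge0_nondecreasing_set_cvg_integral _ (measurableTypeR R) R
    (fun m => S (1 - m.+1%:R^-1)) (fun x => (g x)%:E) mu).
  - move=> m p mp; apply/subsetPset => x [x01 xm]; split => //.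
    by rewrite (le_trans xm)// lerB// lef_pV2 ?posrE// ler_nat.
  - by move=> i; exact: mS.
  - move=> i; apply/measurable_EFinP; exact: measurable_funTS.
  - by move=> i x _; rewrite lee_fin mulr_ge0 ?powR_ge0.
(* If the Beta integral diverged, then [fine +oo = 0] and [x / 0 = 0] would make
   [beta_cdf] constant. *)
have [I1|I1] := eqVneq (\int[mu]_(x in S 1%R) (g x)%:E)%E +oo%E.
  rewrite (_ : (fun _ => _) = cst 0).
    rewrite /Rintegral -/g I1 /= invr0 mulr0; exact: cvg_cst.
  by apply/funext => m; rewrite /Rintegral -/g I1 /= invr0 mulr0.
apply: cvgMl; apply: fine_cvg; rewrite fineK//.
rewrite ge0_fin_numE ?ltey//.
by apply: integral_ge0 => x _; rewrite lee_fin mulr_ge0 ?powR_ge0.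
Qed.

Lemma steiner_beta_cvg1 k n : k != 0%N ->
  (steiner_beta k n (1 - m.+1%:R^-1) : R) @[m --> \oo] --> (steiner_beta k n 1 : R).
Proof.
move=> /negbTE k0; rewrite /steiner_beta k0; case: (k == n).
  (* For [k = n] the mass sits at 0, and [1 - m.+1%:R^-1] is nonnegative even for [m = 0]. *)
  rewrite (_ : (fun _ => _) = cst 1); first by rewrite ler01; exact: cvg_cst.
  by apply/funext => m; rewrite subr_ge0 invf_le1// ler1n.
exact: beta_cdf_cvg1.
Qed.

Lemma steiner_beta0_lt1 n (m : nat) : steiner_beta 0 n (1 - m.+1%:R^-1) = 0 :> R.
Proof. by rewrite /steiner_beta /= lerBrDr gerDl leNgt invr_gt0 ltr0n. Qed.

Lemma convex_cone0 n (C : set 'rV[R]_n) : convex_cone C -> C 0.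
Proof.
move=> [[x Cx] CC].
by have := CC 0 0 x x Cx Cx (lexx _) (lexx _); rewrite !scale0r addr0.
Qed.

Lemma convex_cone_pos n (M : set 'rV[R]_n) : convex_cone (pos M).
Proof.
split.
  by exists 0 => C [CC _]; exact: convex_cone0.
move=> l1 l2 x1 x2 h1 h2 l10 l20 C CM; have [[_ CC] _] := CM.
by apply: CC => //; [exact: h1|exact: h2].
Qed.

(** The Steiner formula at [r = 1] and its limit from below differ only in the term of index 0, so
    [v ord0] is the difference of the two masses. *)
Lemma intrinsic_volume0 n (C : set 'rV[R]_n) (v : 'I_n.+1 -> R)
    (sigma : probability (rVborel R n) R) :
  C 0 -> sphere_uniform sigma -> conic_intrinsic_volumes C v ->
  (v ord0)%:E = sigma [set z : rVborel R n | ~ (edist_set z C ^+ 2 < 1)].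
Proof.
move=> C00 unif /(_ sigma unif) steiner; have C0 : C !=set0 by exists 0.
pose f (z : rVborel R n) : R := edist_set z C ^+ 2.
have mf : measurable_fun setT f by apply: measurable_funX; exact: measurable_edist_set.
have mle r : measurable [set z | f z <= r].
  rewrite (_ : [set z | _] = f @^-1` `]-oo, r]%classic).
    by rewrite -[X in measurable X]setTI; exact: mf.
  by apply/seteqP; split => z /=; rewrite in_itv.
have mlt : measurable [set z | f z < 1].
  rewrite (_ : [set z | _] = f @^-1` `]-oo, 1[%classic).
    by rewrite -[X in measurable X]setTI; exact: mf.
  by apply/seteqP; split => z /=; rewrite in_itv.
have ltU : \bigcup_m [set z | f z <= 1 - m.+1%:R^-1] = [set z | f z < 1].
  apply/seteqP; split => [z [m _] /= fz|z /= fz].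
    by rewrite (le_lt_trans fz)// ltrBlDr ltrDl invr_gt0.
  have [m fm] := ltr_add_invr fz.
  by exists m => //=; rewrite lerBrDr ltW.
have cvg1 : sigma [set z | f z <= 1 - m.+1%:R^-1] @[m --> \oo] --> sigma [set z | f z < 1].
  rewrite -ltU; apply: (@nondecreasing_cvg_mu _ _ _ sigma
    (fun m => [set z | f z <= 1 - m.+1%:R^-1])).
  - by move=> m; exact: mle.
  - by rewrite ltU.
  - move=> m p mp; apply/subsetPset => z /= fz.
    by rewrite (le_trans fz)// lerB// lef_pV2 ?posrE// ler_nat.
(* Below 1 the term of index 0 vanishes, and the other coefficients tend to their values at 1. *)
have cvg2 : sigma [set z | f z <= 1 - m.+1%:R^-1] @[m --> \oo] -->
    (\sum_(k < n) steiner_beta (lift ord0 k) n 1 * v (lift ord0 k))%:E.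
  under eq_fun do rewrite steiner big_ord_recl steiner_beta0_lt1 mul0r add0r.
  apply: cvg_EFin; first by near=> m.
  rewrite (_ : _ \o _ = fun m => \sum_(k < n)
     steiner_beta (lift ord0 k) n (1 - m.+1%:R^-1) * v (lift ord0 k))//.
  elim: (index_enum _) => [|k s IH].
    by under eq_fun do rewrite big_nil; rewrite big_nil; exact: cvg_cst.
  under eq_fun do rewrite big_cons.
  rewrite big_cons; apply: cvgD => //.
  by apply: cvgMl; exact: steiner_beta_cvg1.
(* Every point of the sphere is at distance 1 from the origin, which belongs to [C]. *)
have sum1 : sigma [set z | f z <= 1] = 1%E.
  apply/eqP; rewrite eq_le probability_le1//=.
  have [<- _] := unif; apply: le_measure; rewrite ?inE//.
    rewrite -[X in measurable X]setTI; exact: (measurable_enorm measurableT [set 1]).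
  move=> z /= z1; apply: exprn_ile1; first exact: (edist_set_ge0 z C C0).
  rewrite -z1 -[X in _ <= enorm X]subr0.
  by apply: ge_inf; [exists 0 => _ [u _ <-]; exact: enorm_ge0|exists 0].
have lt1E : sigma [set z | f z < 1] =
    (\sum_(k < n) steiner_beta (lift ord0 k) n 1 * v (lift ord0 k))%:E.
  exact: (cvg_unique (@ereal_hausdorff R) cvg1 cvg2).
transitivity (sigma (~` [set z | f z < 1])); last by [].
rewrite probability_setC// lt1E.
move: sum1; rewrite steiner big_ord_recl {1}/steiner_beta /= lexx mul1r => -[sumv].
by rewrite -EFinB; congr EFin; apply/eqP; rewrite eq_sym subr_eq; apply/eqP/esym.
Unshelve. all: by end_near.
Qed.

End steiner.

(** * From the polar cone of [pos M] to the Gaussian infimum over [M] *)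

Lemma pos_dot_le0 (R : realType) n (M : set 'rV[R]_n) x :
  (forall y, pos M y -> dot x y <= 0) <-> (forall y, M y -> dot x y <= 0).
Proof.
split=> H y My; first by apply: H => C [_]; exact.
(* This set is itself a convex cone containing [M], so it contains the smallest one. *)
apply: (My [set y | dot x y <= 0]); split => //; split.
  by exists 0; rewrite /= /dot big1// => i _; rewrite mxE mulr0.
move=> l1 l2 x1 x2 /= h1 h2 l10 l20; rewrite dotDr !dotZr.
by rewrite -(addr0 0) lerD// mulr_ge0_le0.
Qed.

Lemma gaussian_vector_independent (R : realType) n d (T : measurableType d)
    (P : probability T R) (N : 'I_n -> {RV P >-> R}) :
  independent_RVs N -> (forall i, standard_gaussian (N i)) ->
  gaussian_vector P (fun w => \row_i N i w).
Proof.
move=> indep gauss; split => [i|B mB].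
  by under eq_fun do rewrite mxE; exact: measurable_funP.
transitivity (P [set w | forall i, i \in [set: 'I_n]%SET -> B i (N i w)]).
  congr (P _); apply/seteqP; split => w /= Bw i.
    by move=> _; have := Bw i; rewrite mxE.
  by rewrite mxE; apply: Bw; rewrite inE.
rewrite indep//; apply: eq_big => [i|i _]; first by rewrite inE.
exact: gauss.
Qed.

Theorem corollary3p3 (R : realType) (n : nat) (d : measure_display)
    (T : measurableType d) (P : probability T R)
    (N : 'I_n -> {RV P >-> R})
    (hindep : independent_RVs N)
    (hgauss : forall i, standard_gaussian (N i))
    (M : set 'rV[R]_n) (hM : measurable (M : set (rVborel R n)))
    (hpos : ~ linear_subspace (pos M))
    (v : 'I_n.+1 -> R) (hv : conic_intrinsic_volumes (pos M) v) :
  (v ord0)%:E =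
  P [set w | (0 <= ereal_inf
       [set (\sum_(i < n) t ord0 i * N i w)%:E | t in M])%E].
Proof.
case: n N hindep hgauss M hM hpos v hv => [|n] N indep gauss M _ npos v steiner.
  (* In dimension 0 every convex cone is the whole space, which [npos] excludes. *)
  case: npos; exists fullv; apply/seteqP; split => x _ /=; first exact: memvf.
  have -> : x = 0 by apply/rowP => -[].
  by apply: convex_cone0; exact: convex_cone_pos.
pose X w : 'rV[R]_n.+1 := \row_i N i w.
have gX : gaussian_vector P X by exact: gaussian_vector_independent.
have mX : measurable_fun setT (X : T -> rVborel R n.+1).
  by apply: measurable_fun_rV; case: gX.
pose sigma := sphere_law P X mX.
have unif : sphere_uniform sigma by exact: sphere_law_uniform.
have CC := convex_cone_pos n.+1 M.
rewrite (intrinsic_volume0 _ _ _ sigma (convex_cone0 _ _ CC) unif steiner).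
set A := [set z | _ ].
have C0 : pos M !=set0 by case: CC.
have mA : measurable A.
  rewrite (_ : A = ~` ((fun z => edist_set z (pos M) ^+ 2) @^-1` `]-oo, 1[%classic)).
    apply: measurableC; rewrite -[X in measurable X]setTI.
    by apply: measurable_funX => //; exact: measurable_edist_set.
  by apply/seteqP; split => z /=; rewrite in_itv.
(* The polar cone asks for nonpositive products and the infimum for nonnegative ones; invariance
   under minus the identity reconciles the signs. *)
have orthN1 : (- 1%:M) *m (- 1%:M)^T = 1%:M :> 'M[R]_n.+1.
  by rewrite linearN /= trmx1 mulmxN mulNmx opprK mulmx1.
have [_ /(_ _ orthN1 A mA) <-] := unif.
set A' := [set x | _ ].
have mA' : measurable A'.
  have mN : measurable_fun setT
      (fun x : rVborel R n.+1 => (x : 'rV[R]_n.+1) *m (- 1%:M) : rVborel R n.+1).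
    apply: measurable_fun_rV => i.
    rewrite (_ : (fun _ => _) = fun x : rVborel R n.+1 => - (x : 'rV[R]_n.+1) ord0 i).
      by apply: measurableT_comp => //; exact: measurable_coord.
    by apply/funext => x; rewrite mulmxN mulmx1 mxE.
  by have := mN measurableT A mA; rewrite setTI.
have mX0 : measurable (X @^-1` [set 0]).
  by rewrite -[X in measurable X]setTI; exact: (mX measurableT _ measurable_rV_set0).
have mXA : measurable (X @^-1` (normalize @^-1` A')).
  rewrite -[X in measurable X]setTI; apply: (mX measurableT).
  by rewrite -[X in measurable X]setTI; exact: measurable_normalize.
rewrite [LHS]sphere_lawE.
(* An infimum is nonnegative exactly when all members are; for empty [M] it is [+oo] and both sides
   hold. *)
have nonneg w : (0 <= ereal_inf [set (\sum_(i < n.+1) t ord0 i * N i w)%:E | t in M])%E <->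
    forall t, M t -> dot (- X w) t <= 0.
  have dotE t : dot (- X w) t = - \sum_(i < n.+1) t ord0 i * N i w.
    by rewrite /dot -sumrN; apply: eq_bigr => i _; rewrite !mxE mulNr mulrC.
  split => [H t Mt|H].
    rewrite dotE oppr_le0 -lee_fin (le_trans H)//; apply: ereal_inf_lbound.
    by exists t.
  apply: le_ereal_inf_tmp => _ [t Mt <-]; rewrite lee_fin -oppr_le0 -dotE.
  exact: H.
(* Away from the origin, normalizing multiplies the products by a positive factor and keeps their
   signs. *)
have AE w : X w != 0 -> (normalize @^-1` A') (X w) <->
    (0 <= ereal_inf [set (\sum_(i < n.+1) t ord0 i * N i w)%:E | t in M])%E.
  move=> X0; rewrite nonneg -pos_dot_le0.
  have n1 : enorm (normalize (X w) *m - 1%:M) = 1.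
    by rewrite enorm_orthogonal// enorm_normalize.
  rewrite /A' /A /=.
  rewrite (edist_set_ge1P _ _ CC n1) mulmxN mulmx1 /normalize -scalerN.
  have e0 : 0 < (enorm (X w))^-1.
    by rewrite invr_gt0 lt_neqAle enorm_ge0 eq_sym enorm_eq0 X0.
  by split => H y /H; rewrite dotZl pmulr_rle0.
(* Where [X] vanishes all the sums are 0, so these points belong to the event; they form a null
   set. *)
have -> : [set w | (0 <= ereal_inf [set (\sum_(i < n.+1) t ord0 i * N i w)%:E | t in M])%E] =
    X @^-1` (normalize @^-1` A') `|` X @^-1` [set 0].
  apply/seteqP; split => w /=; have [X0 _|X0] := eqVneq (X w) 0; first by right.
  - by move=> w0; left; apply/AE.
  - by apply/nonneg => t _; rewrite X0 oppr0 /dot big1// => i _; rewrite mxE mul0r.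
  - by move=> [Aw|/eqP X0']; [apply/AE|rewrite X0' in X0].
by rewrite measureU0//; exact: gaussian_vector_eq0.
Qed.
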